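(* Let $\alpha\in\{\pi/2,\pi/3,\pi/4,\pi/6\}$ and $\epsilon>0$. There exist a constant $C>0$ and an integer $n_0$ such that for every integer $n\ge n_0$ there exists an $(\alpha-\epsilon)$AC graph with $n$ vertices and at least $3(\pi/\alpha)n-Cn^{2/3}$ edges (i.e., $3(\pi/\alpha)n-O(n^{2/3})$ edges).
   Context: A geometric graph is a graph whose vertices are distinct points in $\mathbb{R}^2$ and whose edges are straight-line segments joining their endpoints. Two edges cross if the segments intersect at a point other than a common endpoint; the crossing angle is the smaller angle between the two segments. For $\beta>0$, a geometric graph is a $\beta$ angle crossing ($\beta$AC) graph if every pair of crossing edges crosses at an angle of at least $\beta$. *)

(* Defs.v *)
From HB Require Import structures.
From mathcomp Require Import all_boot all_order all_algebra.
From mathcomp Require Import all_classical all_reals all_analysis.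

Set Implicit Arguments.
Unset Strict Implicit.
Unset Printing Implicit Defensive.

Import Order.TTheory GRing.Theory Num.Theory.
Local Open Scope classical_set_scope.
Local Open Scope ring_scope.

Section Plane.
Variable R : realType.
Implicit Types p q r s u v : R * R.

Definition dot u v : R := u.1 * v.1 + u.2 * v.2.

(* The library norm on [R * R] is the sup norm, hence the separate definition. *)
Definition euclidean_norm u : R := Num.sqrt (dot u u).

Definition segment p q : set (R * R) :=
  [set (1 - t) *: p + t *: q | t in [set t : R | 0 <= t <= 1]].

(* Angle in [0, pi] between two nonzero vectors. *)
Definition vector_angle u v : R :=
  acos (dot u v / (euclidean_norm u * euclidean_norm v)).

(* Two intersecting segments form the angles theta and pi - theta.  Collinear
   overlapping segments get crossing angle 0. *)
Definition crossing_angle p q r s : R :=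
  let theta := vector_angle (q - p) (s - r) in Num.min theta (pi - theta).

End Plane.

Record geometric_graph (R : realType) := GeometricGraph {
  vertex : finType;
  adj : rel vertex;
  adj_sym : symmetric adj;
  adj_irr : irreflexive adj;
  pos : vertex -> R * R;
  pos_inj : injective pos
}.

Section AngleCrossing.
Variables (R : realType) (G : geometric_graph R).
Implicit Types a b c d w : vertex G.

Definition edges : {set {set vertex G}} :=
  [set [set x.1; x.2] | x : vertex G * vertex G & adj x.1 x.2]%SET.

(* Crossing of the segments carried by the edges ab and cd. *)
Definition edges_cross a b c d : Prop :=
  exists p : R * R,
    [/\ segment (pos a) (pos b) p, segment (pos c) (pos d) p
      & ~ exists2 w, w \in ([set a; b] :&: [set c; d])%SET & p = pos w].

Definition angle_crossing (beta : R) : Prop :=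
  forall a b c d, adj a b -> adj c d -> ([set a; b] != [set c; d])%SET ->
    edges_cross a b c d ->
    beta <= crossing_angle (pos a) (pos b) (pos c) (pos d).

End AngleCrossing.

(* Main.v *)
(* A lattice triangulation with edge vectors d, f + m d and f + (m + 1) d, where
   det(d, f) = +-1, has no crossing: two of its edge vectors have determinant
   +-1, so by Cramer's rule their segments can only meet at lattice points.  For
   large m its three directions are all close to the direction of d.  Superpose
   pi / alpha such triangulations of the square lattice (for pi/2 and pi/4) or
   of the triangular lattice (for pi/3 and pi/6), taking for the vectors d
   shortest lattice vectors, together with diagonals for pi/4 and pi/6, at
   mutual angles at least alpha.  In a square box with n points only O(sqrt n)
   edges are lost at the boundary. *)

Require Import Defs.
From mathcomp Require Import all_boot all_order all_algebra.
From mathcomp Require Import all_classical all_reals all_analysis.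
From mathcomp Require Import ring lra zify.

Import Order.TTheory GRing.Theory Num.Theory.
Import numFieldNormedType.Exports.
Local Open Scope classical_set_scope.
Local Open Scope ring_scope.

(** * Determinants and angles *)

Definition det {A : comNzRingType} (u v : A * A) : A := u.1 * v.2 - u.2 * v.1.

(** Cosine decreases on [[0, pi]], so bounding the absolute value of the cosine of the angle bounds
    the angle on both sides, as the minimum in [crossing_angle] requires. Squaring removes the
    square roots of the norms. *)
Lemma le_cos_angle {R : realType} (beta : R) (u v : R * R) :
  0 <= beta <= pi / 2 -> 0 < dot u u -> 0 < dot v v ->
  dot u v ^+ 2 <= cos beta ^+ 2 * (dot u u * dot v v) ->
  beta <= vector_angle u v <= pi - beta.
Proof.
move=> /andP[b0 b1] u0 v0 huv.
have pi0 := @pi_gt0 R.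
have cb0 : 0 <= cos beta by apply: cos_ge0_pihalf; apply/andP; split; lra.
have cb1 : cos beta <= 1 by exact: cos_le1.
rewrite /vector_angle /euclidean_norm -sqrtrM ?(ltW u0) //.
set m := Num.sqrt _.
have m0 : 0 < m by rewrite sqrtr_gt0 mulr_gt0.
set x := _ / m.
have xb : `|x| <= cos beta.
  rewrite -(ler_pXn2r (n := 2)) ?nnegrE // real_normK ?num_real //.
  rewrite /x expr_div_n ler_pdivrMr ?exprn_gt0 // sqr_sqrtr //.
  by rewrite mulr_ge0 // ltW.
have /andP[x1 x2] : - cos beta <= x <= cos beta by rewrite -ler_norml.
have x11 : -1 <= x <= 1 by apply/andP; split; lra.
have ca : acos x \in `[0, pi] by rewrite in_itv /= acos_ge0 // acos_lepi.
have cosx : cos (acos x) = x by apply: acosK; rewrite in_itv.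
apply/andP; split; rewrite leNgt; apply/negP => h.
  have : cos beta < cos (acos x).
    by rewrite ltr_cos // in_itv /=; apply/andP; split; lra.
  by rewrite cosx; lra.
have : cos (acos x) < cos (pi - beta).
  by rewrite ltr_cos // in_itv /=; apply/andP; split; lra.
by rewrite cosx addrC cosDpi cosN; lra.
Qed.

(** * Crossings of segments between lattice points *)

Section Lattice.
Context {R : realType} (e1 e2 : R * R).
Hypothesis basis_e : det e1 e2 != 0.
Implicit Types (a b c d z : int * int) (p : R * R) (t s : R) (m : int).

Definition lattice_point z : R * R := z.1%:~R *: e1 + z.2%:~R *: e2.

Local Notation L := lattice_point.

Lemma lattice_pointD a b : L (a + b) = L a + L b.
Proof. by rewrite /L !intrD !scalerDl addrACA. Qed.

Lemma lattice_pointB a b : L (a - b) = L a - L b.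
Proof.
by rewrite /L !rmorphB /= !scalerBl opprD addrACA.
Qed.

Lemma lattice_pointZ m a : L (m * a.1, m * a.2) = m%:~R *: L a.
Proof. by rewrite /L /= !intrM scalerDr !scalerA. Qed.

Lemma det_lattice_point a b : det (L a) (L b) = det e1 e2 * (det a b)%:~R.
Proof. rewrite /det /lattice_point /= rmorphB !rmorphM /= /GRing.scale /=; ring. Qed.

Lemma lattice_point_inj : injective L.
Proof.
move=> a b; move/eqP; rewrite -subr_eq0 -lattice_pointB => /eqP h.
have det0 z : det (a - b) z = 0.
  apply/eqP; rewrite -(intr_eq0 R) -(mulrI_eq0 _ (mulfI basis_e)).
  by rewrite -det_lattice_point h /det /= !mul0r subr0.
have := det0 (1, 0); have := det0 (0, 1).
by case: a b {h det0} => [a1 a2] [b1 b2]; rewrite /det /= => ? ?; congr (_, _); lia.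
Qed.

Lemma int_unit_interval t m : t = m%:~R -> 0 <= t <= 1 -> t = 0 \/ t = 1.
Proof.
move=> ->; rewrite ler0z -[1]/(1%:~R) ler_int => h.
have [->|->] : m = 0 \/ m = 1 by lia.
- by left.
- by right.
Qed.

Lemma segmentC (p q : R * R) : segment p q = segment q p.
Proof.
suff sub (x y : R * R) : segment x y `<=` segment y x by apply/seteqP.
move=> _ [t /= /andP[t0 t1] <-]; exists (1 - t) => /=.
  by apply/andP; split; lra.
by rewrite subKr addrC.
Qed.

Definition common_endpoint a b c d p : Prop :=
  (p = L a \/ p = L b) /\ (p = L c \/ p = L d).

Lemma segmentE (p q x : R * R) : segment p q x ->
  exists2 t, 0 <= t <= 1 & x = p + t *: (q - p).
Proof.
move=> [t t01 <-]; exists t => //.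
by rewrite scalerBr scalerBl scale1r addrA addrAC.
Qed.

Lemma segment_ends (p q : R * R) t : t = 0 \/ t = 1 ->
  p + t *: (q - p) = p \/ p + t *: (q - p) = q.
Proof.
by case=> ->; [left; rewrite scale0r addr0|right; rewrite scale1r addrC subrK].
Qed.

(** Cramer's rule makes the parameters of [p] on both segments integers, and an integer in [[0, 1]]
    marks an endpoint. *)
Lemma unimodular_cross {a b c d p} : `|det (b - a) (d - c)| = 1 ->
  segment (L a) (L b) p -> segment (L c) (L d) p -> common_endpoint a b c d p.
Proof.
move=> D1 /segmentE[t t01 pt] /segmentE[s s01 ps].
have DD : det (b - a) (d - c) * det (b - a) (d - c) = 1.
  by rewrite -expr2 -real_normK ?num_real // D1.
have E : L (c - a) = t *: L (b - a) - s *: L (d - c).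
  rewrite !lattice_pointB.
  apply/eqP; rewrite subr_eq addrAC eq_sym subr_eq eq_sym.
  by rewrite -ps pt addrC.
(* The determinant is its own inverse by [DD], so the division in Cramer's rule becomes a
   multiplication and stays in the integers. *)
have Et : t = (det (c - a) (d - c) * det (b - a) (d - c))%:~R.
  suff H : (det (c - a) (d - c))%:~R = t * (det (b - a) (d - c))%:~R.
    by rewrite intrM H -mulrA -intrM DD mulr1.
  apply: (mulfI basis_e); rewrite mulrCA -!det_lattice_point E.
  by rewrite /det /= /GRing.scale /=; ring.
have Es : s = (det (c - a) (b - a) * det (b - a) (d - c))%:~R.
  suff H : (det (c - a) (b - a))%:~R = s * (det (b - a) (d - c))%:~R.
    by rewrite intrM H -mulrA -intrM DD mulr1.
  apply: (mulfI basis_e); rewrite mulrCA -!det_lattice_point E.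
  by rewrite /det /= /GRing.scale /=; ring.
split.
  by rewrite pt; apply: segment_ends; exact: int_unit_interval Et t01.
by rewrite ps; apply: segment_ends; exact: int_unit_interval Es s01.
Qed.

(** Segments that are translates of each other can meet only if they lie on one line. Pairing with
    [w] then shows that the shift is an integer multiple of the primitive vector [b - a]. *)
Lemma translate_cross {a b c d w p} : det (b - a) w = 1 -> d - c = b - a ->
  segment (L a) (L b) p -> segment (L c) (L d) p ->
  (a, b) = (c, d) \/ common_endpoint a b c d p.
Proof.
move=> D1 E /segmentE[t t01 pt] /segmentE[s s01 ps].
have Lc : L c = L a + (t - s) *: L (b - a).
  apply/eqP; rewrite scalerBl addrA eq_sym subr_eq -{2}E !lattice_pointB.
  by rewrite -ps pt.
have Em : t - s = (det (c - a) w)%:~R.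
  apply: (mulfI basis_e).
  rewrite -det_lattice_point lattice_pointB Lc addrAC subrr add0r.
  rewrite -[LHS]mulr1 -[1]/(1%:~R) -D1 mulrAC -det_lattice_point.
  by rewrite /det /= /GRing.scale /=; ring.
set m := det _ _ in Em.
have cE : c = a + (m * (b - a).1, m * (b - a).2).
  by apply: lattice_point_inj; rewrite lattice_pointD lattice_pointZ -Em.
have dE : d = c + (b - a) by rewrite -E addrC subrK.
have : (-1)%:~R <= (m%:~R : R) <= 1%:~R.
  by rewrite -Em mulrNz; apply/andP; split; lra.
rewrite !ler_int => hm.
(* A zero shift gives the same edge. A shift by 1 or -1 forces the parameters to opposite ends, so
   the segments meet end to end. *)
have [m0|[m1|m1]] : m = 0 \/ m = 1 \/ m = -1 by lia.
- left; rewrite dE cE m0 !mul0r.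
  by rewrite (_ : (0, 0) = 0 :> (int * int)%type) // addr0 addrC subrK.
- have cb : c = b by rewrite cE m1 !mul1r -surjective_pairing addrC subrK.
  have t1 : t = 1 by move: Em; rewrite m1; lra.
  right; split; [right|left].
    by rewrite pt t1 scale1r addrC subrK.
  by rewrite pt t1 scale1r addrC subrK cb.
- have da : d = a.
    rewrite dE cE m1 !mulN1r -[(- _, - _)]/(- (b - a)).
    by rewrite subrK.
  have t0 : t = 0 by move: Em; rewrite m1 mulrNz; lra.
  right; split; [left|right].
    by rewrite pt t0 scale0r addr0.
  by rewrite pt t0 scale0r addr0 da.
Qed.

Lemma dot_gt0 (u : R * R) : u != 0 -> 0 < dot u u.
Proof.
move=> u0; rewrite lt_def /dot addr_ge0 ?sqr_ge0 // andbT.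
apply: contraNneq u0 => /eqP; rewrite paddr_eq0 -?expr2 ?sqr_ge0 //.
by rewrite !sqrf_eq0; case: u => x y /= /andP[/eqP-> /eqP->].
Qed.

Variables (I : finType) (dir : I -> int * int) (beta : R).
Hypothesis beta_acute : 0 < beta <= pi / 2.
(** Coprimality of the two coordinates in Bezout form, as [translate_cross] uses it. *)
Hypothesis dir_primitive : forall i, exists w, det (dir i) w = 1.
(** Either edges in the two directions meet only at endpoints, or the two directions form an angle
    of at least [beta]. *)
Hypothesis dir_transverse : forall i j, i != j ->
  `|det (dir i) (dir j)| = 1 \/
  dot (L (dir i)) (L (dir j)) ^+ 2 <=
    cos beta ^+ 2 * (dot (L (dir i)) (L (dir i)) * dot (L (dir j)) (L (dir j))).

Lemma dir_neq0 i : dir i != 0.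
Proof.
have [w] := dir_primitive i; apply: contra_eqN => /eqP ->.
by rewrite /det /= !mul0r subr0 eq_sym oner_eq0.
Qed.

Lemma dot_dir_gt0 i : 0 < dot (L (dir i)) (L (dir i)).
Proof.
apply: dot_gt0; apply: contra (dir_neq0 i) => /eqP Si0.
apply/eqP/lattice_point_inj; rewrite Si0 /lattice_point /=.
by rewrite !scale0r addr0.
Qed.

(** Parallel vectors have determinant 0, and equal or opposite ones give equality in Cauchy-Schwarz,
    while [cos beta < 1]. This keeps the edge count from counting an edge under two directions. *)
Lemma dir_not_parallel {i j} : dir i = dir j \/ dir i = - dir j -> i = j.
Proof.
move=> par; apply/eqP; apply: contraT => /dir_transverse[|].
  by case: par => ->; rewrite /det /= => /eqP; lia.
have {par}-> : dot (L (dir i)) (L (dir j)) ^+ 2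
    = dot (L (dir i)) (L (dir i)) * dot (L (dir j)) (L (dir j)).
  case: par => ->; first by rewrite expr2.
  rewrite -[- dir j]sub0r lattice_pointB /dot /lattice_point /= /GRing.scale /=.
  by ring.
have pi0 := @pi_gt0 R; have /andP[b0 b1] := beta_acute.
have c0 : 0 <= cos beta by apply: cos_ge0_pihalf; apply/andP; split; lra.
have c1 : cos beta < 1.
  by rewrite -cos0 ltr_cos // in_itv /=; apply/andP; split; lra.
rewrite leNgt => /negP[]; rewrite gtr_pMl ?mulr_gt0 ?dot_dir_gt0 //.
by rewrite exprn_ilt1.
Qed.

(** Equal indices give parallel edges, handled by [translate_cross] once [c] and [d] are ordered
    suitably. Distinct indices fall under one of the two alternatives of [dir_transverse]. *)
Lemma dir_cross {i j a b c d p} :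
  b - a = dir i \/ b - a = - dir i -> d - c = dir j \/ d - c = - dir j ->
  segment (L a) (L b) p -> segment (L c) (L d) p ->
  [\/ a = c /\ b = d \/ a = d /\ b = c, common_endpoint a b c d p
    | beta <= crossing_angle (L a) (L b) (L c) (L d)].
Proof.
move=> ab cd pab pcd; have [ij|/dir_transverse[D1|ang]] := eqVneq i j.
- have [w D1] : exists w, det (b - a) w = 1.
    have [w Dw] := dir_primitive i.
    case: ab => ->; first by exists w.
    by exists (- w); rewrite -Dw /det /=; ring.
  have [E|E] : d - c = b - a \/ c - d = b - a.
    rewrite -(opprB d c); move: ab cd; rewrite -ij.
    by case=> -> [] ->; rewrite ?opprK; [left|right|right|left].
  + have [[-> ->]|h] := translate_cross D1 E pab pcd; last exact: Or32.
    by apply: Or31; left.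
  + rewrite segmentC in pcd.
    have [[-> ->]|[h1 h2]] := translate_cross D1 E pab pcd.
      by apply: Or31; right.
    by apply: Or32; split=> //; case: h2; [right|left].
- apply: Or32; apply: unimodular_cross => //; rewrite -D1.
  have detN (u v : int * int) : (det (- u) v = - det u v) * (det u (- v) = - det u v).
    by split; rewrite /det /=; ring.
  by case: ab => ->; case: cd => ->; rewrite ?detN ?normrN.
- apply: Or33; rewrite /crossing_angle -!lattice_pointB.
  have LN z : L (- z) = - L z.
    by rewrite -[- z]sub0r lattice_pointB /lattice_point /= !scale0r addr0 sub0r.
  have dotN (u v : R * R) : (dot (- u) v = - dot u v) * (dot u (- v) = - dot u v).
    by split; rewrite /dot /=; ring.
  have /andP[b0 b1] := beta_acute.
  have /andP[h1 h2] : beta <= vector_angle (L (b - a)) (L (d - c)) <= pi - beta.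
    apply: le_cos_angle; first by rewrite ltW.
    - by case: ab => ->; rewrite ?LN ?dotN ?opprK dot_dir_gt0.
    - by case: cd => ->; rewrite ?LN ?dotN ?opprK dot_dir_gt0.
    - by case: ab => ->; case: cd => ->; rewrite ?LN ?dotN ?opprK ?sqrrN.
  by rewrite le_min h1 /=; lra.
Qed.

(** * The graph on a box of lattice points and its edge count *)

Variables (n q : nat).
Hypothesis box_fits : (q * q <= n.+1)%N.
Implicit Types x y : 'I_n.+1.

(** Numbering in rows of length [q]: the first [q * q] indices fill the square box and the others
    continue beyond it, so any number of vertices can be reached exactly. *)
Definition coords x : int * int := ((x %/ q)%N%:Z, (x %% q)%N%:Z).

Lemma coords_inj : injective coords.
Proof.
move=> x y [xy1 xy2]; apply/val_inj.
by rewrite /= (divn_eq x q) (divn_eq y q) xy1 xy2.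
Qed.

(** Meant as the inverse of [coords] on the box; elsewhere the absolute values and [inord] give
    arbitrary vertices. *)
Definition point_at z : 'I_n.+1 := inord (`|z.1| * q + `|z.2|)%N.

Lemma point_atK z : 0 <= z.1 < q%:Z -> 0 <= z.2 < q%:Z ->
  coords (point_at z) = z.
Proof.
case: z => z1 z2 /=; case: z1 => // z1; case: z2 => // z2 /= h1 h2.
rewrite /coords /point_at /= inordK; last by nia.
have [q0 z2q] : (0 < q)%N /\ (z2 < q)%N by lia.
by rewrite divnMDl // modnMDl divn_small // modn_small // addn0.
Qed.

Definition lattice_adj x y : bool :=
  [exists i, (coords y - coords x == dir i) || (coords x - coords y == dir i)].

Lemma lattice_adj_sym : symmetric lattice_adj.
Proof. by move=> x y; apply: eq_existsb => i; rewrite orbC. Qed.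

Lemma lattice_adj_irr : irreflexive lattice_adj.
Proof.
move=> x; apply/existsP=> -[i]; rewrite subrr orbb eq_sym.
by rewrite (negPf (dir_neq0 i)).
Qed.

Definition lattice_graph : geometric_graph R :=
  GeometricGraph lattice_adj_sym lattice_adj_irr
    (inj_comp lattice_point_inj coords_inj).

Lemma lattice_graph_angle : angle_crossing lattice_graph beta.
Proof.
have dirE x y : lattice_adj x y -> exists i,
    coords y - coords x = dir i \/ coords y - coords x = - dir i.
  move=> /existsP[i /orP[]/eqP h]; exists i; first by left.
  by right; rewrite -h opprB.
move=> a b c d /dirE[i ab] /dirE[j cd] neq [p [pab pcd no]].
have [[[/coords_inj ac /coords_inj bd]|[/coords_inj ad /coords_inj bc]]|[pe1 pe2]|//]
  := dir_cross ab cd pab pcd.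
- by rewrite ac bd eqxx in neq.
- by rewrite ad bc finset.setUC eqxx in neq.
(* Here [p] is an endpoint of both edges, and injectivity of [pos] makes it a shared vertex, which a
   crossing excludes. *)
case: no; have inj := pos_inj (g := lattice_graph).
case: pe1 pe2 => -> [] /inj e.
- by exists a => //; rewrite !inE eqxx e eqxx.
- by exists a => //; rewrite !inE eqxx e eqxx orbT.
- by exists b => //; rewrite !inE eqxx e eqxx orbT.
- by exists b => //; rewrite !inE eqxx e eqxx !orbT.
Qed.

Variable K : nat.
Hypothesis dir_bounded : forall i, `|(dir i).1| <= K%:Z /\ `|(dir i).2| <= K%:Z.

(** Starting points at distance at least [K] from the sides of the box have all their outgoing edges
    inside it. The truncated subtraction makes the bound trivial for small [q]. *)
Lemma card_lattice_edges :
  (#|I| * (q - 2 * K) ^ 2 <= #|edges lattice_graph|)%N.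
Proof.
set r := (q - 2 * K)%N.
pose T := (I * ('I_r * 'I_r))%type.
pose start (t : T) : int * int :=
  (K%:Z + t.2.1%:Z, K%:Z + t.2.2%:Z).
have startK (t : T) : coords (point_at (start t)) = start t.
  by case: t => i [[x xr] [y yr]]; apply: point_atK => /=; lia.
have endK (t : T) : coords (point_at (start t + dir t.1)) = start t + dir t.1.
  case: t => i [[x xr] [y yr]]; have [] := dir_bounded i.
  by move=> ? ?; apply: point_atK => /=; lia.
pose edge (t : T) : {set vertex lattice_graph} :=
  [set point_at (start t); point_at (start t + dir t.1)]%SET.
have edge_inj : injective edge.
  move=> t u tu.
  have memE x : x \in edge u -> coords x = start u \/ coords x = start u + dir u.1.
    by rewrite !inE => /orP[]/eqP->; rewrite ?startK ?endK; [left|right].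
  have := memE (point_at (start t)); rewrite startK -tu !inE eqxx => /(_ isT) eq1.
  have := memE (point_at (start t + dir t.1)).
  rewrite endK -tu !inE eqxx orbT => /(_ isT) eq2.
  have tu1 : dir t.1 = dir u.1 \/ dir t.1 = - dir u.1.
    case: eq1 eq2 => -> [] e.
    - by have := dir_neq0 t.1; rewrite -[dir t.1](addKr (start u)) e addNr eqxx.
    - by left; apply: addrI e.
    - right; apply: (addrI (start u + dir u.1)); rewrite e.
      by rewrite addrK.
    - have := dir_neq0 t.1.
      by rewrite -[dir t.1](addKr (start u + dir u.1)) e addNr eqxx.
  have {}tu1 := dir_not_parallel tu1.
  (* The directions now agree, so a start of [t] at the end of [u] would make [dir u.1] or its
     double vanish. *)
  case: eq1 => eq1; last first.
    case: eq2 => eq2; last by move: eq2; rewrite -eq1 tu1 => /eqP;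
      rewrite -subr_eq0 addrAC subrr add0r (negPf (dir_neq0 _)).
    have /eqP := dir_neq0 u.1; case.
    move: eq2; rewrite eq1 tu1 -addrA -[RHS]addr0 => /addrI.
    case: (dir u.1) => x y [] h1 h2; congr (_, _); lia.
  case: t u eq1 tu1 {tu memE eq2} => [i [x y]] [j [x' y']] [] eq1 eq2 /= ->.
  by congr (_, (_, _)); apply: val_inj => /=; lia.
have -> : (#|I| * r ^ 2 = #|edge @: [set: T]|%SET)%N.
  by rewrite card_imset // cardsT !card_prod !card_ord.
apply/subset_leq_card/fintype.subsetP => _ /imsetP[t _ ->].
apply/imsetP; exists (point_at (start t), point_at (start t + dir t.1)) => //.
by rewrite inE; apply/existsP; exists t.1; rewrite startK endK addrC addKr eqxx.
Qed.

End Lattice.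

(** * From a box to every number of vertices *)

Lemma nat_sqrt (n : nat) : exists q : nat, (q * q <= n < q.+1 * q.+1)%N.
Proof.
elim: n => [|n [q hq]]; first by exists 0.
have [h|h] := leqP (q.+1 * q.+1)%N n.+1; [exists q.+1|exists q]; lia.
Qed.

(** The boundary loss is a multiple of the square root of [n]; it is weakened here to the exponent
    2/3. *)
Lemma nat_sqrt_le_powR {R : realType} (n q : nat) : (0 < n)%N ->
  (q * q <= n)%N -> q%:R <= n%:R `^ (2 / 3) :> R.
Proof.
move=> n0 qn; apply: (@le_trans _ _ (n%:R `^ 2^-1)); last first.
  by apply: ler_powR; [rewrite ler1n|lra].
rewrite powR12_sqrt ?ler0n // -(ler_pXn2r (n := 2)) ?nnegrE ?sqrtr_ge0 //.
by rewrite sqr_sqrtr // expr2 -natrM ler_nat.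
Qed.

Lemma exists_lattice_graphs {R : realType} {e1 e2 : R * R} {I : finType}
    {dir : I -> int * int} {beta : R} :
  det e1 e2 != 0 -> 0 < beta <= pi / 2 ->
  (forall i, exists w, det (dir i) w = 1) ->
  (forall i j, i != j -> let L := lattice_point e1 e2 in
    `|det (dir i) (dir j)| = 1 \/
    dot (L (dir i)) (L (dir j)) ^+ 2 <=
      cos beta ^+ 2 * (dot (L (dir i)) (L (dir i)) * dot (L (dir j)) (L (dir j)))) ->
  exists2 C : R, 0 < C & forall n : nat, (0 < n)%N ->
    exists G : geometric_graph R,
      [/\ #|vertex G| = n, angle_crossing G beta
        & #|I|%:R * n%:R - C * n%:R `^ (2 / 3) <= #|edges G|%:R].
Proof.
move=> basis_e b01 prim trans.
pose K := (\max_i maxn `|(dir i).1| `|(dir i).2|)%N.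
have KP i : `|(dir i).1| <= K%:Z /\ `|(dir i).2| <= K%:Z.
  have := leq_bigmax (F := fun i => maxn `|(dir i).1| `|(dir i).2|) i.
  by rewrite -/K; lia.
(* Each direction loses at most [4 * K * q] edges at the sides of the box and [2 * q] for the points
   outside it. The successor keeps the constant positive even if [I] is empty. *)
exists (#|I| * (4 * K + 2)).+1%:R; first by rewrite ltr0n.
move=> [//|n] _; have [q /andP[qn nq]] := nat_sqrt n.+1.
exists (lattice_graph _ _ basis_e _ _ prim n q); split; first exact: card_ord.
  exact: lattice_graph_angle b01 _ trans _ _.
have hE := card_lattice_edges _ _ basis_e _ _ _ b01 prim trans _ _ qn _ KP.
have hn : (#|I| * n.+1 <= #|I| * (q - 2 * K) ^ 2 + (#|I| * (4 * K + 2)).+1 * q)%N.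
  have : (n.+1 <= (q - 2 * K) ^ 2 + (4 * K + 2) * q)%N by nia.
  by nia.
rewrite lerBlDr.
apply: (@le_trans _ _ (#|I| * (q - 2 * K) ^ 2 + (#|I| * (4 * K + 2)).+1 * q)%N%:R).
  by rewrite -natrM ler_nat.
rewrite natrD lerD ?ler_nat // natrM ler_wpM2l //.
exact: nat_sqrt_le_powR.
Qed.

(* The three edge directions of a lattice triangulation whose edges are all
   nearly parallel to [df.1]. *)
Definition fan (k : nat) (df : (int * int) * (int * int)) (o : option bool) :
    int * int :=
  if o is Some b then
    (df.2.1 + (k + b).+1%:Z * df.1.1, df.2.2 + (k + b).+1%:Z * df.1.2)
  else df.1.

(** [df.1] pairs with [df.2], the other two vectors with [df.1]; the partner is negated if the sign
    is wrong. *)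
Lemma fan_primitive {k df o} : `|det df.1 df.2| = 1 ->
  exists w, det (fan k df o) w = 1.
Proof.
have has_unit_det (z w : int * int) : `|det z w| = 1 -> exists w, det z w = 1.
  move=> D1; have [Dw|Dw] : det z w = 1 \/ det z w = - 1 by lia.
    by exists w.
  by exists (- w); rewrite -[RHS]opprK -Dw /det /=; ring.
move=> D1; case: o => [b|]; last exact: has_unit_det D1.
by apply: (has_unit_det _ df.1); rewrite -D1 -normrN; congr (`|_|); rewrite /det /=; ring.
Qed.

Lemma fan_unimodular {k df o o'} : `|det df.1 df.2| = 1 -> o != o' ->
  `|det (fan k df o) (fan k df o')| = 1.
Proof.
case: df => -[d1 d2] [f1 f2]; rewrite /det /=.
by case: o o' => [[]|] [[]|] //=; rewrite ?addn0 ?addn1; lia.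
Qed.

(** * Limiting directions of fans *)

Section FanLimit.
Context {R : realType} (e1 e2 : R * R).
Local Notation L := (lattice_point e1 e2).

(** Dividing [f + m d] by [m] gives [d + f / m], which tends to [d]. The positive factor [r] does
    not affect angles. *)
Lemma fan_cvg df o : exists2 X : nat -> R * R,
  (X k).1 @[k --> \oo] --> (L df.1).1 /\ (X k).2 @[k --> \oo] --> (L df.1).2
  & forall k, exists2 r : R, 0 < r & L (fan k df o) = r *: X k.
Proof.
pose h k : R := if o is Some b then (k + b).+1%:R^-1 else 0.
have h0 : h k @[k --> \oo] --> 0.
  rewrite /h; case: o {h} => [b|]; last exact: cvg_cst.
  have := @cvg_harmonic R; rewrite -(cvg_shiftn b); exact.
exists (fun k => L df.1 + h k *: L df.2) => [|k].
  have lim x y : x + h k * y @[k --> \oo] --> x.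
    rewrite -[X in _ --> X]addr0 -[X in _ --> _ + X](mul0r y).
    by apply: cvgD; [exact: cvg_cst|apply: cvgM => //; exact: cvg_cst].
  by split; apply: lim.
rewrite /h; case: o {h h0} => [b|] /=.
  exists (k + b).+1%:R => //.
  rewrite scalerDr scalerA mulfV ?pnatr_eq0 // scale1r.
  have -> : (df.2.1 + (k + b).+1%:Z * df.1.1, df.2.2 + (k + b).+1%:Z * df.1.2)
      = df.2 + ((k + b).+1%:Z * df.1.1, (k + b).+1%:Z * df.1.2) by [].
  by rewrite lattice_pointD lattice_pointZ addrC.
by exists 1 => //; rewrite scale0r addr0 scale1r.
Qed.

Lemma dot_cvg (X Y : nat -> R * R) (x y : R * R) :
  (X k).1 @[k --> \oo] --> x.1 /\ (X k).2 @[k --> \oo] --> x.2 ->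
  (Y k).1 @[k --> \oo] --> y.1 /\ (Y k).2 @[k --> \oo] --> y.2 ->
  dot (X k) (Y k) @[k --> \oo] --> dot x y.
Proof. by move=> [X1 X2] [Y1 Y2]; apply: cvgD; apply: cvgM. Qed.

(** The inequality is homogeneous of degree 2 in [u] and in [v], so it may be tested on the
    convergent rescalings; strictness in the limit makes it hold for all large [k]. *)
Lemma fan_angle df df' o o' (c : R) :
  dot (L df.1) (L df'.1) ^+ 2 <
    c * (dot (L df.1) (L df.1) * dot (L df'.1) (L df'.1)) ->
  \forall k \near \oo,
    let u := L (fan k df o) in let v := L (fan k df' o') in
    dot u v ^+ 2 <= c * (dot u u * dot v v).
Proof.
have [X Xl XE] := fan_cvg df o; have [Y Yl YE] := fan_cvg df' o'.
rewrite -subr_gt0 => hlim.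
have : c * (dot (X k) (X k) * dot (Y k) (Y k)) - dot (X k) (Y k) ^+ 2
    @[k --> \oo] --> c * (dot (L df.1) (L df.1) * dot (L df'.1) (L df'.1))
                     - dot (L df.1) (L df'.1) ^+ 2.
  apply: cvgB.
    by apply: cvgM; [exact: cvg_cst|apply: cvgM; exact: dot_cvg].
  by rewrite expr2; apply: cvgM; exact: dot_cvg.
move=> /cvgr_gt /(_ _ hlim); apply: filterS => k /= hk.
have [r r0 ->] := XE k; have [s s0 ->] := YE k.
have dotZ (a b : R) (u v : R * R) : dot (a *: u) (b *: v) = a * b * dot u v.
  by rewrite /dot /= /GRing.scale /=; ring.
rewrite !dotZ -subr_ge0.
rewrite [leRHS](_ : _ = (r * s) ^+ 2 * (c * (dot (X k) (X k) * dot (Y k) (Y k))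
    - dot (X k) (Y k) ^+ 2)); last by ring.
by rewrite mulr_ge0 ?sqr_ge0 // ltW.
Qed.

End FanLimit.

Lemma angle_crossing_le {R : realType} (G : geometric_graph R) (beta beta' : R) :
  beta <= beta' -> angle_crossing G beta' -> angle_crossing G beta.
Proof. by move=> h AC a b c d ab cd n p; exact: le_trans h (AC a b c d ab cd n p). Qed.

Lemma exists_fan_graphs {R : realType} {e1 e2 : R * R} {m : nat}
    {df : 'I_m -> (int * int) * (int * int)} {alpha eps : R} :
  det e1 e2 != 0 -> 0 < alpha <= pi / 2 -> 0 < eps ->
  (forall i, `|det (df i).1 (df i).2| = 1) ->
  (forall i j, i != j -> let L := lattice_point e1 e2 in
    dot (L (df i).1) (L (df j).1) ^+ 2 <=
      cos alpha ^+ 2 * (dot (L (df i).1) (L (df i).1) *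
                        dot (L (df j).1) (L (df j).1))) ->
  exists2 C : R, 0 < C & forall n : nat, (0 < n)%N ->
    exists G : geometric_graph R,
      [/\ #|vertex G| = n, angle_crossing G (alpha - eps)
        & (3 * m)%:R * n%:R - C * n%:R `^ (2 / 3) <= #|edges G|%:R].
Proof.
move=> basis_e /andP[a0 a1] eps0 D1 ang.
(* At least [alpha - eps] as required, positive even for large [eps], and below [alpha], so that the
   angle condition becomes strict. *)
pose beta := Num.max (alpha - eps) (alpha / 2).
have [b1 b2] : alpha - eps <= beta /\ 0 < beta < alpha.
  rewrite /beta; case: (lerP (alpha - eps) (alpha / 2)) => ?; split=> //; try (apply/andP; split); lra.
have pi0 := @pi_gt0 R.
have cos_lt : cos alpha ^+ 2 < cos beta ^+ 2.
  rewrite ltr_pXn2r ?nnegrE ?cos_ge0_pihalf //; try by apply/andP; split; lra.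
  by rewrite ltr_cos ?in_itv /=; lra.
have : \forall k \near \oo, forall p : ('I_m * option bool) * ('I_m * option bool),
    p.1.1 != p.2.1 ->
    let u := lattice_point e1 e2 (fan k (df p.1.1) p.1.2) in
    let v := lattice_point e1 e2 (fan k (df p.2.1) p.2.2) in
    dot u v ^+ 2 <= cos beta ^+ 2 * (dot u u * dot v v).
  (* There are finitely many pairs of fan vectors, so one [k] serves them all. *)
  apply: filter_forall => -[[i o] [j o']] /=.
  have [_|ij] := eqVneq i j; first by near=> k.
  apply: filterS (@fan_angle R e1 e2 (df i) (df j) o o' (cos beta ^+ 2) _) => //.
  apply: le_lt_trans (ang i j ij) _.
  have pos l : 0 < dot (lattice_point e1 e2 (df l).1) (lattice_point e1 e2 (df l).1).
    have [w Dw] := fan_primitive (k := 0) (o := None) (D1 l).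
    exact: (@dot_dir_gt0 R e1 e2 basis_e unit (fun=> (df l).1)
      (fun _ => ex_intro _ w Dw) tt).
  by rewrite ltr_pM2r // mulr_gt0.
move=> /filter_ex[k hk].
pose dir (io : 'I_m * option bool) := fan k (df io.1) io.2.
have trans i j : i != j -> let L := lattice_point e1 e2 in
    `|det (dir i) (dir j)| = 1 \/
    dot (L (dir i)) (L (dir j)) ^+ 2 <=
      cos beta ^+ 2 * (dot (L (dir i)) (L (dir i)) * dot (L (dir j)) (L (dir j))).
  case: i j => [i o] [j o']; have [<-|ij] := eqVneq i j => ne.
    left; apply: fan_unimodular => //=; apply: contraNneq ne => ->.
    by rewrite eqxx.
  by right; exact: (hk (i, o, (j, o'))).
have prim i : exists w, det (dir i) w = 1 by exact: fan_primitive.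
have bb : 0 < beta <= pi / 2 by apply/andP; split; lra.
have [C C0 HC] := exists_lattice_graphs basis_e bb prim trans.
exists C => // n /HC[G [Gn GA GE]]; exists G; split => //.
  exact: angle_crossing_le GA.
by move: GE; rewrite card_prod card_option card_bool card_ord mulnC.
Unshelve. all: by end_near.
Qed.

(* Twice the inner product on the square lattice (h = 0) or on the triangular
   lattice (h = 1). *)
Definition gram (h : nat) (u v : int * int) : int :=
  2 * (u.1 * v.1) + h%:Z * (u.1 * v.2 + u.2 * v.1) + 2 * (u.2 * v.2).

(** Both basis vectors have length 1 and their inner product is [h / 2], so doubling clears the
    denominators. *)
Lemma dot_gram {R : realType} (h : nat) (u v : int * int) : (h <= 1)%N ->
  let L := lattice_point (1, 0) (h%:R / 2, Num.sqrt (1 - (h%:R / 2) ^+ 2)) in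
  dot (L u) (L v) = (gram h u v)%:~R / 2 :> R.
Proof.
move=> h1; set s := Num.sqrt _; rewrite /= /gram.
have hR : (h%:R : R) <= 1 by rewrite (ler_nat R h 1).
have hR0 : 0 <= (h%:R : R) by rewrite ler0n.
have ss : s * s = 1 - (h%:R / 2) ^+ 2 by rewrite -expr2 sqr_sqrtr //; nra.
rewrite /dot /lattice_point /= /GRing.scale /=.
rewrite [X in _ + X](_ : _ = u.2%:~R * v.2%:~R * (s * s)); last by ring.
by rewrite ss; field.
Qed.

(** When [4 * cos alpha ^+ 2] is an integer, the angle condition is an inequality between integers,
    which can be checked by computation on explicit vectors. *)
Lemma exists_gram_graphs {R : realType} {h c : nat}
    {ds : seq ((int * int) * (int * int))} {alpha eps : R} :
  (h <= 1)%N -> 0 < alpha <= pi / 2 -> 0 < eps ->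
  4 * cos alpha ^+ 2 = c%:R ->
  all (fun df => `|det df.1 df.2| == 1) ds ->
  pairwise (fun df df' => 4 * gram h df.1 df'.1 ^+ 2 <=
              c%:Z * (gram h df.1 df.1 * gram h df'.1 df'.1)) ds ->
  exists2 C : R, 0 < C & forall n : nat, (0 < n)%N ->
    exists G : geometric_graph R,
      [/\ #|vertex G| = n, angle_crossing G (alpha - eps)
        & (3 * size ds)%:R * n%:R - C * n%:R `^ (2 / 3) <= #|edges G|%:R].
Proof.
move=> h1 a01 eps0 cosE /allP unim ang.
pose x0 : (int * int) * (int * int) := ((0, 0), (0, 0)).
apply: (@exists_fan_graphs R (1, 0) (h%:R / 2, Num.sqrt (1 - (h%:R / 2) ^+ 2)) _
  (fun i : 'I_(size ds) => nth x0 ds i)) => //.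
- rewrite /det /= mul1r mul0r subr0 gt_eqF // sqrtr_gt0.
  have hR : (h%:R : R) <= 1 by rewrite (ler_nat R h 1).
  have hR0 : 0 <= (h%:R : R) by rewrite ler0n.
  by nra.
- by move=> i; apply/eqP/unim/mem_nth.
move=> i j ij /=; rewrite !dot_gram //.
suff : 4 * gram h (nth x0 ds i).1 (nth x0 ds j).1 ^+ 2 <=
    c%:Z * (gram h (nth x0 ds i).1 (nth x0 ds i).1 *
            gram h (nth x0 ds j).1 (nth x0 ds j).1).
  rewrite -(ler_int R) !intrM -pmulrn -cosE.
  by lra.
have gramC u v : gram h u v = gram h v u by rewrite /gram; ring.
have [lt_ij|lt_ji|/val_inj eq_ij] := ltngtP i j.
- by apply: (pairwiseP x0 ang i j) => //; rewrite inE.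
- by rewrite gramC (mulrC (gram _ _ _)); apply: (pairwiseP x0 ang j i) => //; rewrite inE.
- by rewrite eq_ij eqxx in ij.
Qed.

(** * The four angles and their direction sets *)

Lemma cos_pi4_sqr {R : realType} : 4 * cos (pi / 4) ^+ 2 = 2 :> R.
Proof.
have := cos_mulr2n (pi / 4 : R).
have -> : pi / 4 *+ 2 = pi / 2 :> R by lra.
by rewrite cos_pihalf => h; lra.
Qed.

(** Doubling [pi / 3] gives its supplement, so the cosine is the positive root of
    [2 * x ^+ 2 + x - 1]. *)
Lemma cos_pi3 {R : realType} : cos (pi / 3) = 1 / 2 :> R.
Proof.
have pi0 := @pi_gt0 R.
have c0 : 0 < cos (pi / 3 : R) by apply: cos_gt0_pihalf; apply/andP; split; lra.
have E : cos (pi / 3 *+ 2) = - cos (pi / 3 : R).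
  by rewrite -(cosN (pi / 3)) -cosDpi; congr cos; lra.
rewrite cos_mulr2n in E; nra.
Qed.

Lemma cos_pi6_sqr {R : realType} : 4 * cos (pi / 6) ^+ 2 = 3 :> R.
Proof.
have := cos_mulr2n (pi / 6 : R).
have -> : pi / 6 *+ 2 = pi / 3 :> R by lra.
by rewrite cos_pi3 => h; lra.
Qed.

Theorem theorem3 (R : realType) (alpha eps : R)
    (halpha : alpha \in [:: pi / 2; pi / 3; pi / 4; pi / 6])
    (heps : 0 < eps) :
  exists (C : R) (n0 : nat), 0 < C /\
    forall n : nat, (n0 <= n)%N ->
      exists G : geometric_graph R,
        [/\ #|vertex G| = n,
            angle_crossing G (alpha - eps)
          & 3 * (pi / alpha) * n%:R - C * n%:R `^ (2 / 3) <= #|edges G|%:R].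
Proof.
have pi0 := @pi_gt0 R.
suff [h [c [ds [h1 cosE [unim ang] sizeE]]]] : exists (h c : nat) ds,
    [/\ (h <= 1)%N, 4 * cos alpha ^+ 2 = c%:R,
        all (fun df : (int * int) * (int * int) => `|det df.1 df.2| == 1) ds /\
        pairwise (fun df df' => 4 * gram h df.1 df'.1 ^+ 2 <=
              c%:Z * (gram h df.1 df.1 * gram h df'.1 df'.1)) ds
      & pi / alpha = (size ds)%:R].
  have a01 : 0 < alpha <= pi / 2.
    by move: halpha; rewrite !inE => /or4P[]/eqP ->; apply/andP; split; lra.
  have [C C0 H] := exists_gram_graphs h1 a01 heps cosE unim ang.
  by exists C, 1%N; split=> // n /H[G HG]; exists G; rewrite sizeE -natrM.
have pi_neq0 : pi != 0 :> R by rewrite gt_eqF.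
move: halpha; rewrite !inE => /or4P[]/eqP ->.
(* The axes of the square lattice. In each pair of these lists the second vector only completes the
   first to a lattice basis. *)
- exists 0%N, 0%N, [:: ((1, 0), (0, 1)); ((0, 1), (1, 0))]; split => //.
    by rewrite cos_pihalf expr0n mulr0.
  by rewrite invf_div mulrCA mulfV ?mulr1.
(* The three shortest directions of the triangular lattice. *)
- exists 1%N, 1%N, [:: ((1, 0), (0, 1)); ((0, 1), (1, 0)); ((1, -1), (1, 0))].
  split => //; first by rewrite cos_pi3; field.
  by rewrite invf_div mulrCA mulfV ?mulr1.
(* The axes and diagonals of the square lattice. *)
- exists 0%N, 2%N, [:: ((1, 0), (0, 1)); ((0, 1), (1, 0)); ((1, 1), (0, 1));
    ((1, -1), (1, 0))]; split => //; first exact: cos_pi4_sqr.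
  by rewrite invf_div mulrCA mulfV ?mulr1.
(* The shortest directions of the triangular lattice and their bisectors, the long diagonals of its
   rhombi. *)
- exists 1%N, 3%N, [:: ((1, 0), (0, 1)); ((0, 1), (1, 0)); ((1, -1), (1, 0));
    ((1, 1), (0, 1)); ((2, -1), (1, 0)); ((1, -2), (0, 1))].
  split => //; first exact: cos_pi6_sqr.
  by rewrite invf_div mulrCA mulfV ?mulr1.
Qed.
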